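(* For every instance $(G,c,r,m)$, the unrestricted MV-mTSP$_0$ with arbitrary tours (P3) and the unrestricted MV-mTSP$_0$ with disjoint tours (P4) have the same optimal value: $\mathsf{OPT}_{\mathrm{P3}}=\mathsf{OPT}_{\mathrm{P4}}$.
   Context: Instance: a finite vertex set $V$; $G=(V,E)$ is the complete undirected graph on $V$, including a self-loop $vv$ at each $v$; symmetric costs $c(uv)\geq 0$ (self-loop costs $c(vv)$ are not assumed to be zero) that are metric: $c(uw)\leq c(uv)+c(vw)$ for all $u,v,w\in V$, and $c(vv)\leq 2\min_{u\in V\setminus\{v\}}c(uv)$ for all $v\in V$; requests $r:V\to\mathbb{Z}_{\geq 1}$; an integer $m\geq 1$ (number of agents). A multigraph is a multiset $X$ of edges (self-loops allowed) on $V$; $\operatorname{cost}(X)=\sum_{uv} x(uv)c(uv)$, where $x(uv)$ is the multiplicity of $uv$ in $X$. The degree $\dot\delta_X(v)$ counts each copy of the self-loop $vv$ twice. An MVTSP tour is a connected multigraph in which every degree is even; a multigraph with even degrees visits $v$ exactly $\dot\delta_X(v)/2$ times. Both problems ask for a minimum-cost multigraph $X$ visiting each $v\in V$ exactly $r(v)$ times, such that: (P3) the edge multiset of $X$ can be partitioned into at most $m$ not necessarily vertex-disjoint MVTSP tours; (P4) $X$ has at most $m$ connected components, each of them an MVTSP tour. $\mathsf{OPT}_{\mathrm{P}i}$ denotes the minimum cost for problem P$i$. *)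

(* Defs.v *)
From HB Require Import structures.
From mathcomp Require Import all_boot all_order all_algebra.

Set Implicit Arguments.
Unset Strict Implicit.
Unset Printing Implicit Defensive.

Import Order.TTheory GRing.Theory Num.Theory.

(* Edges of the complete undirected graph with self-loops on V: an edge is its
   set of endpoints, a singleton for a self-loop.  Functions on edges are thus
   symmetric in the two endpoints by construction. *)
Definition edge (V : finType) := {e : {set V} | 0 < #|e| <= 2}.

Lemma edge_of_subproof (V : finType) (u v : V) : 0 < #|[set u; v]| <= 2.
Proof. by rewrite cards2; case: (u != v). Qed.

Definition edge_of (V : finType) (u v : V) : edge V :=
  exist _ [set u; v] (edge_of_subproof u v).

Definition is_loop (V : finType) (e : edge V) : bool := #|val e| == 1.

(* X e is the multiplicity of the edge e in the multigraph X. *)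
Definition multigraph (V : finType) := {ffun edge V -> nat}.

Definition deg (V : finType) (X : multigraph V) (v : V) : nat :=
  \sum_(e : edge V | v \in val e) (if is_loop e then 2 else 1) * X e.

Definition cost (R : realFieldType) (V : finType) (c : edge V -> R)
    (X : multigraph V) : R :=
  (\sum_(e : edge V) (X e)%:R * c e)%R.

(* For a vertex v alone in V the minimum in c(vv) <= 2 min_(u != v) c(uv)
   ranges over the empty set, and the condition is void. *)
Definition metric_cost (R : realFieldType) (V : finType) (c : edge V -> R)
    : Prop :=
  (forall u v w : V,
     c (edge_of u w) <= c (edge_of u v) + c (edge_of v w))%R /\
  (forall v u : V, u != v ->
     c (edge_of v v) <= 2 * c (edge_of u v))%R.

Definition adj (V : finType) (X : multigraph V) : rel V :=
  fun u v => 0 < X (edge_of u v).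

(* The vertices of a multiset of edges are the endpoints of its edges, so a
   tour need not touch all of V. *)
Definition connected_multigraph (V : finType) (X : multigraph V) : Prop :=
  forall u v : V, 0 < deg X u -> 0 < deg X v -> connect (adj X) u v.

Definition is_tour (V : finType) (X : multigraph V) : Prop :=
  connected_multigraph X /\ (forall v : V, ~~ odd (deg X v)).

(* A vertex v of even degree is visited deg X v / 2 times. *)
Definition visits_exactly (V : finType) (X : multigraph V) (r : V -> nat)
    : Prop :=
  forall v : V, deg X v = (r v).*2.

(* The blocks of a partition are nonempty; their multiplicities add up. *)
Definition tour_partition (V : finType) (X : multigraph V)
    (s : seq (multigraph V)) : Prop :=
  (forall Y, Y \in s -> is_tour Y /\ exists e, 0 < Y e) /\
  (forall e : edge V, X e = \sum_(Y <- s) Y e).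

Definition feasibleP3 (V : finType) (r : V -> nat) (m : nat)
    (X : multigraph V) : Prop :=
  visits_exactly X r /\
  exists2 s : seq (multigraph V), size s <= m & tour_partition X s.

Definition components (V : finType) (X : multigraph V) : {set {set V}} :=
  equivalence_partition (connect (adj X)) [set: V].

Definition induced (V : finType) (X : multigraph V) (C : {set V})
    : multigraph V :=
  [ffun e : edge V => if val e \subset C then X e else 0].

Definition feasibleP4 (V : finType) (r : V -> nat) (m : nat)
    (X : multigraph V) : Prop :=
  [/\ visits_exactly X r,
      #|components X| <= m &
      forall C : {set V}, C \in components X -> is_tour (induced X C)].

(* opt is the minimum (attained) of the cost over the feasible multigraphs;
   it is unique when it exists. *)
Definition is_OPT (R : realFieldType) (V : finType) (c : edge V -> R)
    (feasible : multigraph V -> Prop) (opt : R) : Prop :=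
  (exists2 X, feasible X & cost c X = opt) /\
  (forall X, feasible X -> opt <= cost c X)%R.

(* Main.v *)
Require Import Defs.
From HB Require Import structures.
From mathcomp Require Import all_boot all_order all_algebra.

Set Implicit Arguments.
Unset Strict Implicit.
Unset Printing Implicit Defensive.

Import Order.TTheory GRing.Theory Num.Theory.

(** (P3) and (P4) have the same feasible multigraphs.
    A tour of a partition is connected, hence lies in one component of X, and
    since every vertex is visited every component contains a tour: so X has at
    most as many components as the partition has blocks.  Conversely the
    components of X form a partition into tours.  Either way feasibility
    amounts to the degree condition together with the bound on the number of
    components.  The minimum is attained because the degrees bound all
    multiplicities, and a Hamiltonian cycle with r(v) - 1 extra loops at each v
    is feasible. *)

Section Multigraphs.
Variable V : finType.
Implicit Types (X Y : multigraph V) (e : edge V) (u v w : V).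

Lemma edge_ofC u v : edge_of u v = edge_of v u.
Proof. by apply: val_inj; rewrite /= setUC. Qed.

Lemma edge_ofP e v : v \in val e -> exists w, e = edge_of v w.
Proof.
move=> ve; have := valP e; rewrite (cardsD1 v) ve /= add1n ltnS.
(* What is left of [e] without [v] is a second endpoint, or nothing when [e] is a loop. *)
rewrite leq_eqVlt ltnS leqn0 => /orP[/cards1P[w ew]|].
  by exists w; apply: val_inj; rewrite /= -ew setD1K.
rewrite cards_eq0 => /eqP e0.
by exists v; apply: val_inj; rewrite /= -(setD1K ve) e0 setU0 setUid.
Qed.

Lemma edge_ex e : exists v, v \in val e.
Proof. by apply/card_gt0P; case/andP: (valP e). Qed.

Lemma adj_sym X : symmetric (adj X).
Proof. by move=> u v; rewrite /adj edge_ofC. Qed.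

Lemma connect_adjC X : connect_sym (adj X).
Proof. exact: sym_connect_sym (adj_sym X). Qed.

Lemma multiplicity_le_deg X e v : v \in val e -> X e <= deg X v.
Proof.
move=> ve; rewrite /deg (bigD1 e) //=; apply: leq_trans (leq_addr _ _).
by case: ifP => _; rewrite ?mul1n // leq_pmull.
Qed.

Lemma deg_gt0 X v :
  reflect (exists2 e : edge V, v \in val e & 0 < X e) (0 < deg X v).
Proof.
apply: (iffP idP) => [|[e ve Xe]]; last first.
  exact: leq_trans Xe (multiplicity_le_deg X ve).
rewrite lt0n sum_nat_eq0 negb_forall => /existsP[e].
by rewrite negb_imply muln_eq0 negb_or -!lt0n => /and3P[ve _ Xe]; exists e.
Qed.

Lemma deg_sum (I : finType) (F : I -> multigraph V) (G : multigraph V) v :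
  (forall e, G e = \sum_i F i e) -> deg G v = \sum_i deg (F i) v.
Proof.
move=> GF; rewrite /deg exchange_big; apply: eq_bigr => e _.
by rewrite GF big_distrr.
Qed.

Definition single_edge (u v : V) : multigraph V :=
  [ffun e => (e == edge_of u v) : nat].

(** For [u = v] both terms on the right count, matching the weight 2 of a loop. *)
Lemma deg_single_edge u v w : deg (single_edge u v) w = (w == u) + (w == v).
Proof.
have edgew : (w \in val (edge_of u v)) = (w == u) || (w == v).
  by rewrite /= !inE.
have wt e : single_edge u v e = (e == edge_of u v) by rewrite ffunE.
case we : (w \in val (edge_of u v)); last first.
  rewrite /deg big1 => [|e ew].
    by move: edgew; rewrite we; do 2!case: eqP.
  rewrite wt; case: eqP ew => [->|_ _]; first by rewrite we.
  by rewrite muln0.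
rewrite /deg (bigD1 (edge_of u v)) //= big1 => [|e /andP[_ /negPf eN]].
  rewrite wt eqxx muln1 addn0 /is_loop /= cards2 eqSS.
  move: we; rewrite edgew; case: (eqVneq u v) => [->|uv].
    by case: eqP.
  by case: (eqVneq w u) => [->|_] /=; [rewrite (negPf uv)|move->].
by rewrite wt eN muln0.
Qed.

Definition component X v : {set V} := [set w | connect (adj X) v w].

Lemma componentsP X C :
  reflect (exists v, C = component X v) (C \in components X).
Proof.
have E v : [set y in [set: V] | connect (adj X) v y] = component X v.
  by apply/setP => w; rewrite !inE.
apply: (iffP imsetP) => [[v _ ->]|[v ->]]; exists v; by rewrite ?E.
Qed.

Lemma component_eq X u v : connect (adj X) u v -> component X u = component X v.
Proof.
move=> uv; apply/setP => w; rewrite !inE.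
exact: (same_connect (connect_adjC X) uv).
Qed.

Lemma mem_component X v : v \in component X v.
Proof. by rewrite inE connect0. Qed.

Lemma component_edge X e u v :
  0 < X e -> u \in val e -> u \in component X v -> val e \subset component X v.
Proof.
move=> Xe /edge_ofP[w ew]; rewrite inE => vu; rewrite {}ew in Xe *.
apply/subsetP => x; rewrite !inE => /orP[]/eqP-> //.
by apply: connect_trans vu (connect1 _).
Qed.

(** An edge of positive multiplicity with one endpoint in a component lies inside it, so restricting
    to the component loses no edge at its vertices. *)
Lemma deg_induced_component X u v :
  deg (induced X (component X u)) v = if v \in component X u then deg X v else 0.
Proof.
case: ifP => vC; last first.
  rewrite /deg big1 // => e ve; rewrite ffunE.
  case: (boolP (_ \subset _)) => [/subsetP sub|_]; last by rewrite muln0.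
  by rewrite sub in vC.
apply: eq_bigr => e ve; rewrite ffunE.
case: (posnP (X e)) => [->|Xe]; first by rewrite if_same.
by rewrite (component_edge Xe ve vC).
Qed.

Lemma induced_component_connected X u :
  connected_multigraph (induced X (component X u)).
Proof.
move=> v w; rewrite !deg_induced_component.
case: ifP => // uv _; case: ifP => // uw _.
have : connect (adj X) v w.
  rewrite !inE in uv uw.
  by apply: connect_trans uw; rewrite connect_adjC.
(* A path of [X] that starts in the component never leaves it, so each of its edges survives in the
   induced multigraph. *)
case/connectP => p; elim: p v uv => [|x p IHp] v uv /=; first by move=> _ ->.
case/andP => vx px wE.
have sub : val (edge_of v x) \subset component X u.
  by apply: (component_edge vx _ uv); rewrite !inE eqxx.
apply: (@connect_trans _ _ x); first by apply: connect1; rewrite /adj ffunE sub.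
by apply: IHp px wE; apply: (subsetP sub); rewrite !inE eqxx orbT.
Qed.

(** Only the component of an endpoint of [e] can contribute, since distinct components are
    disjoint. *)
Lemma sum_induced_components X e :
  X e = \sum_(C in components X) induced X C e.
Proof.
have [u ue] := edge_ex e.
case: (posnP (X e)) => [X0|Xe].
  by rewrite X0 big1 // => C _; rewrite ffunE X0 if_same.
have uC : component X u \in components X by apply/componentsP; exists u.
rewrite (bigD1 _ uC) /= big1 => [|C /andP[/componentsP[v ->] vu]].
  by rewrite ffunE (component_edge Xe ue (mem_component X u)) addn0.
rewrite ffunE; case: (boolP (_ \subset _)) => // /subsetP sub; move: (sub u ue).
by rewrite inE => /component_eq E; rewrite E eqxx in vu.
Qed.

Section Requests.
Variables (r : V -> nat) (r_ge1 : forall v, 1 <= r v).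

Lemma visits_deg_gt0 X v : visits_exactly X r -> 0 < deg X v.
Proof. by move=> ->; rewrite double_gt0. Qed.

Lemma induced_component_tour X u :
  visits_exactly X r -> is_tour (induced X (component X u)).
Proof.
move=> Xr; split=> [|v]; first exact: induced_component_connected.
by rewrite deg_induced_component; case: ifP; rewrite // Xr odd_double.
Qed.

Lemma components_le_tour_partition X s :
  visits_exactly X r -> tour_partition X s -> #|components X| <= size s.
Proof.
move=> Xr [tour_s Xs].
(* Send a block to the component of [X] around some vertex it touches; the default [set0] is for
   blocks without edges. It suffices that every component is such an image. *)
pose comp Y := oapp (component X) set0 [pick u | 0 < deg Y u].
rewrite -(size_map comp s); apply: leq_trans (card_size _).
apply/subset_leq_card/subsetP => _ /componentsP[v ->].
have /deg_gt0[e ve Xe] := visits_deg_gt0 v Xr.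
(* Some block uses the edge [e] at [v]. Being connected, it joins [v] to the vertex picked by
   [comp], and its edges are edges of [X]. *)
have /hasP[Y Ys Ye] : has (fun Y => 0 < (Y : multigraph V) e) s.
  rewrite Xs lt0n in Xe; apply: contraNT Xe => /hasPn s0.
  rewrite big_seq big1 // => Y /s0.
  by rewrite -eqn0Ngt => /eqP.
have Yv : 0 < deg Y v by apply/deg_gt0; exists e.
apply/mapP; exists Y => //; rewrite /comp; case: pickP => [u Yu|/(_ v)]; last first.
  by rewrite Yv.
have sYX : subrel (adj Y) (connect (adj X)).
  move=> x y xy; apply: connect1; rewrite /adj Xs (big_rem _ Ys) /=.
  exact: leq_trans xy (leq_addr _ _).
apply: component_eq; apply: (connect_sub sYX).
by have [[Yconn _] _] := tour_s Y Ys; apply: Yconn.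
Qed.

(** The feasibility condition common to both problems, in boolean form so that it can serve as the
    predicate of a finite minimization. *)
Definition few_components m X :=
  [forall v, deg X v == (r v).*2] && (#|components X| <= m).

Lemma few_componentsP m X :
  reflect (visits_exactly X r /\ #|components X| <= m) (few_components m X).
Proof.
apply: (iffP andP) => -[Xr Xm]; split=> //; last by apply/forallP => v; rewrite Xr.
by move=> v; apply/eqP/(forallP Xr).
Qed.

Lemma feasibleP4P m X : reflect (feasibleP4 r m X) (few_components m X).
Proof.
apply: (iffP (few_componentsP m X)) => [[Xr Xm]|[Xr Xm _]] //; split=> //.
by move=> C /componentsP[u ->]; apply: induced_component_tour.
Qed.

Lemma feasibleP3P m X : reflect (feasibleP3 r m X) (few_components m X).
Proof.
apply: (iffP (few_componentsP m X)) => [[Xr Xm]|[Xr [s sm Xs]]]; last first.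
  by split=> //; apply: leq_trans (components_le_tour_partition Xr Xs) sm.
split=> //; exists [seq induced X C | C <- enum (components X)].
  by rewrite size_map -cardE.
split=> [Y /mapP[C]|e]; last by rewrite big_map big_enum -sum_induced_components.
rewrite mem_enum => /componentsP[u ->] ->; split.
  exact: induced_component_tour.
(* Blocks must be nonempty: [u] is visited, so its component contains an edge. *)
have /deg_gt0[e ue Xe] := visits_deg_gt0 u Xr.
by exists e; rewrite ffunE (component_edge Xe ue (mem_component X u)).
Qed.

(** The cycle follows the enumeration of [V]. It degenerates to a loop on one vertex and to a
    doubled edge on two. *)
Definition cycle_with_loops : multigraph V :=
  [ffun e => \sum_v (single_edge v (next (enum V) v) e
                     + (r v).-1 * single_edge v v e)].

Lemma cycle_with_loops_visits : visits_exactly cycle_with_loops r.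
Proof.
move=> w; pose F v : multigraph V :=
  [ffun e => single_edge v (next (enum V) v) e + (r v).-1 * single_edge v v e].
have -> : deg cycle_with_loops w = \sum_v deg (F v) w.
  by apply: deg_sum => e; rewrite ffunE; apply: eq_bigr => v _; rewrite [RHS]ffunE.
have degF v : deg (F v) w =
    (w == v) + (w == next (enum V) v) + (r v).-1 * (w == v).*2.
  rewrite -addnn -!deg_single_edge /deg big_distrr -big_split /=.
  by apply: eq_bigr => e _; rewrite [F v e]ffunE mulnDr [in RHS]mulnCA.
under eq_bigr do rewrite degF.
have sum_eq : \sum_v (w == v) = 1.
  by rewrite (bigD1 w) //= eqxx big1 // => v; rewrite eq_sym => /negPf->.
(* [next] permutes [V], so the cycle enters [w] exactly once, just as it leaves it once. *)
have next_inj : injective (next (enum V)).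
  exact: can_inj (prev_next (enum_uniq V)).
have sum_next : \sum_v (w == next (enum V) v) = 1.
  by rewrite -sum_eq [RHS](reindex_inj next_inj).
rewrite !big_split /= sum_next sum_eq (bigD1 w) //= eqxx big1 => [|v].
  by rewrite addn0 muln2 -[1 + 1]/(1.*2) -doubleD add1n prednK.
by rewrite eq_sym => /negPf->; rewrite muln0.
Qed.

Lemma cycle_with_loops_connect u v : connect (adj cycle_with_loops) u v.
Proof.
have : fconnect (next (enum V)) u v.
  by rewrite (fconnect_cycle (cycle_next (enum_uniq V))) mem_enum.
apply: connect_sub => {u v}u _ /eqP<-; apply: connect1.
by rewrite /adj ffunE (bigD1 u) //= !ffunE eqxx.
Qed.

Lemma cycle_with_loops_few_components m :
  1 <= m -> few_components m cycle_with_loops.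
Proof.
move=> m_ge1; apply/few_componentsP; split; first exact: cycle_with_loops_visits.
(* Every component is all of [V]; an inclusion suffices, which also covers empty [V]. *)
apply: leq_trans m_ge1; apply: leq_trans (_ : #|[set [set: V]]| <= 1).
  apply/subset_leq_card/subsetP => _ /componentsP[u ->]; rewrite inE; apply/eqP.
  by apply/setP => v; rewrite !inE cycle_with_loops_connect.
by rewrite cards1.
Qed.

Let bound := \sum_v (r v).*2.

Lemma visits_multiplicity_le X e : visits_exactly X r -> X e <= bound.
Proof.
move=> Xr; have [v ve] := edge_ex e.
apply: leq_trans (multiplicity_le_deg X ve) _.
by rewrite Xr /bound (bigD1 v) //= leq_addr.
Qed.

Lemma few_components_min (R : realFieldType) (c : edge V -> R) m : 1 <= m ->
  exists2 X, few_components m X &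
    forall Y, few_components m Y -> (cost c X <= cost c Y)%R.
Proof.
move=> m_ge1.
(* Multigraphs with multiplicities at most [bound] form a finite type, over which a minimum exists.
   The truncation by [inord] changes no multigraph with the required degrees. *)
pose of_bounded (f : {ffun edge V -> 'I_bound.+1}) : multigraph V :=
  [ffun e => f e : nat].
pose to_bounded X : {ffun edge V -> 'I_bound.+1} := [ffun e => inord (X e)].
have ofK X : few_components m X -> of_bounded (to_bounded X) = X.
  case/few_componentsP=> Xr _; apply/ffunP => e.
  by rewrite !ffunE inordK // ltnS visits_multiplicity_le.
pose P f := few_components m (of_bounded f).
have Pz : P (to_bounded cycle_with_loops).
  by rewrite /P ofK // cycle_with_loops_few_components.
have [f Pf minf] := arg_minP (P := P) (fun f => cost c (of_bounded f)) Pz.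
by exists (of_bounded f) => // Y Ym; rewrite -[Y]ofK // minf // /P ofK.
Qed.

End Requests.
End Multigraphs.

Theorem claim2p4 (R : realFieldType) (V : finType) (c : edge V -> R)
    (r : V -> nat) (m : nat)
    (c_ge0 : forall e : edge V, (0 <= c e)%R)
    (c_metric : metric_cost c)
    (r_ge1 : forall v : V, 1 <= r v)
    (m_ge1 : 1 <= m) :
  exists opt : R,
    is_OPT c (feasibleP3 r m) opt /\ is_OPT c (feasibleP4 r m) opt.
Proof.
have [X Xm minX] := few_components_min r_ge1 c m_ge1.
exists (cost c X); split; split.
- by exists X => //; apply/feasibleP3P.
- by move=> Y /(feasibleP3P r_ge1) /minX.
- by exists X => //; apply/feasibleP4P.
- by move=> Y /feasibleP4P /minX.
Qed.
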